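(* Let $\{D_I\}_{I\in\binom{[n]}{2}}$ be a family of positive real numbers satisfying the triangle inequalities, and let $x,y\in[n]$ be such that $D_{x,y}=\min_{1\le i<j\le n}D_{i,j}$. Define $$X=\{x\}\cup\{i\in[n]\setminus\{x,y\}:\ \exists\, j_1,\dots,j_t\in[n],\ t\text{ odd, with } D_{x,i}=D_{x,j_1}+D_{j_1,j_2}+\dots+D_{j_t,i}\text{ and all summands indecomposable}\},$$ $$Y=\{i\in[n]\setminus\{x\}:\ D_{x,i}\text{ is indecomposable, or }\exists\, j_1,\dots,j_t\in[n],\ t\text{ even, with } D_{x,i}=D_{x,j_1}+\dots+D_{j_t,i}\text{ and all summands indecomposable}\}.$$ Then the family is bigraphlike (on some pair of subsets of $[n]$) if and only if: (1) $X\cap Y=\emptyset$; and (2) for any distinct $a,b\in X$ there exists $z\in Y$ with $D_{a,b}=D_{a,z}+D_{z,b}$, and for any distinct $a,b\in Y$ there exists $z\in X$ with $D_{a,b}=D_{a,z}+D_{z,b}$.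
   Context: Write $D_{i,j}=D_{\{i,j\}}$. Triangle inequalities: $D_{i,j}\le D_{i,k}+D_{k,j}$ for distinct $i,j,k$. $D_{i,j}$ is indecomposable if $D_{i,j}<D_{i,z}+D_{z,j}$ for all $z\in[n]\setminus\{i,j\}$. A graph $B$ (finite, simple, connected) is bipartite on $X',Y'\subseteq V(B)$ if $X'\cap Y'=\emptyset$, $X'\cup Y'=V(B)$ and every edge joins $X'$ to $Y'$. A positive-weighted graph $\mathcal G=(G,w)$ has $w:E(G)\to\mathbb R_{>0}$, and $D_{i,j}(\mathcal G)$ is the minimum total weight of a path from $i$ to $j$. The family is bigraphlike on $X',Y'$ if there is a positive-weighted bipartite graph $\mathcal B=(B,w)$ on $X',Y'$ with $V(B)=[n]$ such that $D_{i,j}(\mathcal B)=D_{i,j}$ for all distinct $i,j$. *)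

(* Defs.v *)
From HB Require Import structures.
From mathcomp Require Import all_boot all_order all_algebra.
From mathcomp Require Import boolp reals.

Set Implicit Arguments.
Unset Strict Implicit.
Unset Printing Implicit Defensive.

Import Order.TTheory GRing.Theory Num.Theory.
Local Open Scope ring_scope.

(* Families indexed by 2-subsets, as well as edge weights, are encoded as      *)
(* functions on all of {set V}; their values outside the 2-subsets (resp. the  *)
(* edges) are irrelevant.                                                      *)

Section Families.
Variables (R : realType) (V : finType).
Implicit Types (D : {set V} -> R) (i j x y z : V).

Definition pair_val D i j : R := D [set i; j].

Definition triangle_inequalities D : Prop :=
  forall i j k, i != j -> i != k -> j != k ->
    pair_val D i j <= pair_val D i k + pair_val D k j.

(* i != j is required because D_{i,j} only makes sense for distinct i, j.      *)
Definition indecomposable D : rel V := fun i j =>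
  (i != j) && [forall z in [set: V] :\: [set i; j],
                 pair_val D i j < pair_val D i z + pair_val D z j].

(* chain_sum D x [:: j_1; ...; j_t] = D_{x,j_1} + D_{j_1,j_2} + ... +          *)
(* D_{j_(t-1),j_t}.                                                            *)
Fixpoint chain_sum D x (s : seq V) : R :=
  if s is j :: s' then pair_val D x j + chain_sum D j s' else 0.

Definition indec_chain D x i (js : seq V) : Prop :=
  pair_val D x i = chain_sum D x (rcons js i)
  /\ path (indecomposable D) x (rcons js i).

Definition Xset D x y : {set V} :=
  x |: [set i in [set: V] :\: [set x; y] |
         `[< exists js : seq V, odd (size js) /\ indec_chain D x i js >]].

Definition Yset D x : {set V} :=
  [set i in [set: V] :\ x |
    `[< indecomposable D x i
        \/ exists js : seq V, ~~ odd (size js) /\ indec_chain D x i js >]].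

End Families.

Record sgraph (V : finType) := SGraph {
  adj :> rel V;
  adj_sym : symmetric adj;
  adj_irrefl : irreflexive adj;
  adj_connected : forall u v, connect adj u v
}.

Definition bipartite_on (V : finType) (B : sgraph V) (X' Y' : {set V}) : Prop :=
  [/\ X' :&: Y' = set0,
      X' :|: Y' = [set: V]
    & forall u v, B u v ->
        (u \in X' /\ v \in Y') \/ (u \in Y' /\ v \in X')].

Record pwgraph (R : realType) (V : finType) := PWGraph {
  pwg_graph :> sgraph V;
  pwg_weight : {set V} -> R;
  pwg_weight_gt0 : forall u v, pwg_graph u v -> 0 < pwg_weight [set u; v]
}.

Section Distances.
Variables (R : realType) (V : finType).

(* The path visits i, then the elements of p in order.                         *)
Definition gpath (G : sgraph V) (i j : V) (p : seq V) : Prop :=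
  [/\ path G i p, last i p = j & uniq (i :: p)].

Definition is_wdist (G : pwgraph R V) (i j : V) (d : R) : Prop :=
  (exists2 p, gpath G i j p & chain_sum (pwg_weight G) i p = d)
  /\ (forall p, gpath G i j p -> d <= chain_sum (pwg_weight G) i p).

Definition bigraphlike_on (D : {set V} -> R) (X' Y' : {set V}) : Prop :=
  exists G : pwgraph R V,
    bipartite_on G X' Y'
    /\ forall i j, i != j -> is_wdist G i j (pair_val D i j).

End Distances.

(* Main.v *)
(* Every D_{i,j} is a sum of indecomposable ones, and the indecomposable pairs
   are forced to be edges of any graph realizing the family, with weight
   D_{i,j}.  Hence parity of the length of indecomposable chains from x
   determines the sides: X and Y must be the two sides of any bipartite
   realization.  Conversely (2) says that no indecomposable pair lies within
   X or within Y, so the graph of indecomposable pairs, weighted by D, is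
   bipartite on X and Y; it always realizes D. *)

Require Import Defs.
From HB Require Import structures.
From mathcomp Require Import all_boot all_order all_algebra.
From mathcomp Require Import boolp reals.

Set Implicit Arguments.
Unset Strict Implicit.
Unset Printing Implicit Defensive.

Import Order.TTheory GRing.Theory Num.Theory.
Local Open Scope ring_scope.

(** * Indecomposable pairs and sums along walks *)

Section Chains.
Variables (R : realType) (V : finType).
Implicit Types (D : {set V} -> R) (i j u v z : V) (p : seq V).

Lemma pair_valC D i j : pair_val D i j = pair_val D j i.
Proof. by rewrite /pair_val setUC. Qed.

Lemma indecomposable_sym D : symmetric (indecomposable D).
Proof.
move=> i j; rewrite /indecomposable eq_sym; congr andb.
apply: eq_forallb => z; rewrite [[set i; j]]setUC (pair_valC D i j).
by rewrite addrC (pair_valC D z) (pair_valC D i).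
Qed.

Lemma indecomposable_neq D : subrel (indecomposable D) [rel i j | i != j].
Proof. by move=> i j /andP[]. Qed.

Lemma indecomposableP D i j :
  reflect (i != j /\ forall z, z != i -> z != j ->
             pair_val D i j < pair_val D i z + pair_val D z j)
          (indecomposable D i j).
Proof.
apply: (iffP andP) => -[ij H]; split=> //.
  move=> z zi zj; move/forall_inP: H; apply.
  by rewrite !inE (negPf zi) (negPf zj).
apply/forall_inP => z; rewrite !inE andbT negb_or => /andP[zi zj]; exact: H.
Qed.

Lemma chain_sum_cat D i p q :
  chain_sum D i (p ++ q) = chain_sum D i p + chain_sum D (last i p) q.
Proof. by elim: p i => [|j p IH] i /=; rewrite ?add0r// IH addrA. Qed.

Lemma chain_sum_ge0 D (e : rel V) i p :
  (forall u v, e u v -> 0 <= pair_val D u v) ->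
  path e i p -> 0 <= chain_sum D i p.
Proof.
move=> D0; elim: p i => //= j p IH i /andP[ij pj].
by rewrite addr_ge0 ?D0// IH.
Qed.

(** Cutting closed detours out of a walk only drops nonnegative terms. This bridges arbitrary walks
    and the simple paths over which [is_wdist] minimizes. *)
Lemma chain_sum_shorten D (e : rel V) i p :
  (forall u v, e u v -> 0 <= pair_val D u v) -> path e i p ->
  exists q, [/\ path e i q, last i q = last i p, uniq (i :: q)
              & chain_sum D i q <= chain_sum D i p].
Proof.
move=> D0; elim: p i => [|j p IH] i /=; first by exists [::].
case/andP=> ij /IH[q [pq <- uq le_qp]].
have [iq|iNq] := boolP (i \in j :: q); last first.
  by exists (j :: q); split; rewrite ?lerD2l //= ?ij // iNq.
have : path e i (j :: q) by rewrite /= ij.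
have: chain_sum D i (j :: q) <= pair_val D i j + chain_sum D j p.
  by rewrite /= lerD2l.
rewrite -[last j q]/(last i (j :: q)).
(* The walk returns to [i]: keep only the part [r2] after that return. *)
move: uq; move: (j :: q) iq => r; case/path.splitP => r1 r2.
rewrite cat_path last_cat last_rcons chain_sum_cat last_rcons cat_uniq rcons_uniq.
move=> /and3P[_ /hasPn r2N ur2] le_r /andP[pr1 pr2]; exists r2; split=> //.
  rewrite /= ur2 andbT; apply/negP => /r2N/=.
  by rewrite mem_rcons mem_head.
by apply: le_trans le_r; rewrite lerDr; apply: chain_sum_ge0 pr1.
Qed.

End Chains.

(** * Decomposing distances into indecomposable ones *)

Section Metric.
Variables (R : realType) (V : finType) (D : {set V} -> R).
Hypothesis D_gt0 : forall i j, i != j -> 0 < pair_val D i j.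
Hypothesis D_triangle : triangle_inequalities D.
Implicit Types (i j u v z : V) (p : seq V).

Lemma indecomposable_ge0 i j : indecomposable D i j -> 0 <= pair_val D i j.
Proof. by move/indecomposable_neq => /D_gt0/ltW. Qed.

Lemma pair_val_le_chain_sum i p :
  path (indecomposable D) i p -> i != last i p ->
  pair_val D i (last i p) <= chain_sum D i p.
Proof.
elim: p i => [|j p IH] i /=; first by rewrite eqxx.
case/andP=> dij pj il.
(* A tail that closes up at [j] is bounded below by 0: the triangle inequality says nothing about
   [pair_val D j j], the value on a singleton. *)
have [jl|jl] := eqVneq j (last j p).
  by rewrite -jl lerDl (chain_sum_ge0 indecomposable_ge0 pj).
apply: le_trans (_ : pair_val D i j + pair_val D j (last j p) <= _).
  by apply: D_triangle => //; [exact: indecomposable_neq dij | rewrite eq_sym].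
by rewrite lerD2l IH.
Qed.

Lemma decomposableP i j : i != j -> ~~ indecomposable D i j ->
  exists z, [/\ z != i, z != j & pair_val D i j = pair_val D i z + pair_val D z j].
Proof.
move=> ij; rewrite negb_and ij /= => /forall_inPn[z].
rewrite !inE andbT negb_or -leNgt => /andP[zi zj] le_z.
exists z; split=> //; apply/le_anti; rewrite le_z andbT.
by apply: D_triangle => //; rewrite eq_sym.
Qed.

Lemma indec_walk i j : i != j ->
  exists p, [/\ path (indecomposable D) i p, last i p = j
              & chain_sum D i p = pair_val D i j].
Proof.
(* Induction on the number of pairs with a strictly smaller value: by positivity, both summands of a
   decomposition of [pair_val D i j] are smaller than it. *)
pose closer i j := [set q : V * V | (q.1 != q.2) &&
                      (pair_val D q.1 q.2 < pair_val D i j)].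
have closer_lt u v i' j' : u != v -> pair_val D u v < pair_val D i' j' ->
    (#|closer u v| < #|closer i' j'|)%N.
  move=> uv lt_uv; apply/proper_card/properP; split.
    by apply/subsetP=> q; rewrite !inE => /andP[-> /lt_trans->].
  by exists (u, v); rewrite !inE /= uv ?lt_uv// ltxx.
have [k] := ubnP #|closer i j|; elim: k i j => // k IH i j; rewrite ltnS => le_k ij.
have [dij|] := boolP (indecomposable D i j).
  by exists [:: j]; rewrite /= dij addr0.
case/(decomposableP ij) => z [zi zj Dij].
have iz : i != z by rewrite eq_sym.
have [|p [pp lp sp]] := IH i z _ iz.
  by apply: leq_trans le_k; apply: closer_lt => //; rewrite Dij ltrDl D_gt0.
have [|q [pq lq sq]] := IH z j _ zj.
  by apply: leq_trans le_k; apply: closer_lt => //; rewrite Dij ltrDr D_gt0.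
by exists (p ++ q); rewrite cat_path last_cat chain_sum_cat lp sp sq pp.
Qed.

Lemma indec_chain_exists i j : i != j -> exists js, indec_chain D i j js.
Proof.
move=> ij; have [p] := indec_walk ij.
case: (lastP p) => [|s k] [pp]; first by move=> /= eij; rewrite eij eqxx in ij.
rewrite last_rcons => kj sp; exists s; rewrite kj in pp sp; split=> //.
Qed.

Lemma Xset_Yset_cover x y i :
  indecomposable D x y -> (i \in Xset D x y) || (i \in Yset D x).
Proof.
move=> dxy; rewrite !inE !andbT.
(* [y] is barred from [Xset] by definition, so it is placed by indecomposability of [D_{x,y}]; any
   other vertex by the parity of some chain. *)
have [//|ix] := eqVneq i x; have [->|iy] := eqVneq i y.
  by apply/orP; right; apply/asboolP; left.
have [js c] : exists js, indec_chain D x i js by apply: indec_chain_exists; rewrite eq_sym.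
have [o|o] := boolP (odd (size js)); apply/orP; [left|right]; apply/asboolP.
  by exists js.
by right; exists js.
Qed.

(** * Two-colorings that alternate along indecomposable pairs *)

Section Coloring.
Variable S : {set V}.
Hypothesis S_flip : forall u v, indecomposable D u v -> (v \in S) = (u \notin S).

Lemma path_coloring u p : path (indecomposable D) u p ->
  (last u p \in S) = (u \in S) (+) odd (size p).
Proof.
elim: p u => [|v p IH] u /=; first by rewrite addbF.
by case/andP=> uv /IH->; rewrite (S_flip uv) addNb addbN.
Qed.

(** Parity gives only the inclusions of [Xset] in [S] and of [Yset] in its complement;
    [Xset_Yset_cover] makes them equalities. *)
Lemma Xset_Yset_coloring x y : x \in S -> indecomposable D x y ->
  Xset D x y = S /\ Yset D x = ~: S.
Proof.
move=> xS dxy.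
(* A chain with [t] intermediate vertices has [t + 1] steps, so odd [t] means the side of [x]. *)
have chain_end i js : indec_chain D x i js -> (i \in S) = odd (size js).
  by case=> _ /path_coloring; rewrite last_rcons xS size_rcons /= negbK.
have XS i : i \in Xset D x y -> i \in S.
  rewrite !inE andbT => /orP[/eqP->//|/andP[_ /asboolP[js [o c]]]].
  by rewrite (chain_end _ _ c).
have YS i : i \in Yset D x -> i \notin S.
  rewrite !inE andbT => /andP[_ /asboolP[dxi|[js [o c]]]]; first by rewrite (S_flip dxi) xS.
  by rewrite (chain_end _ _ c).
split; apply/setP=> i; move: (XS i) (YS i) (Xset_Yset_cover i dxy); rewrite ?in_setC.
  case: (i \in Xset D x y) => [->//|_]; case: (i \in Yset D x) => // H _.
  by rewrite (negPf (H _)).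
case: (i \in Yset D x) => [_ ->//|]; case: (i \in Xset D x y) => // H.
by rewrite H.
Qed.

End Coloring.

(** * Constraints on an arbitrary realization *)

Section Realization.
Variable G : pwgraph R V.
Hypothesis G_dist : forall i j, i != j -> is_wdist G i j (pair_val D i j).

Lemma edge_weight_ge i j : G i j -> pair_val D i j <= pair_val (pwg_weight G) i j.
Proof.
move=> gij; have ij : i != j.
  by apply/negP=> /eqP e; move: gij; rewrite e adj_irrefl.
have [_ /(_ [:: j])] := G_dist ij; rewrite /= addr0; apply.
by split; rewrite //= ?gij ?inE ?ij.
Qed.

(** Take [z] next to [i] on a shortest path: the first edge weighs at least [D_{i,z}], the rest at
    least [D_{z,j}], and the triangle inequality gives the converse bound. *)
Lemma first_edge i j : i != j ->
  exists2 z, G i z & z = j \/ pair_val D i j = pair_val D i z + pair_val D z j.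
Proof.
move=> ij; have [[[|z p] [pp lp up] sp] _] := G_dist ij.
  by rewrite -lp eqxx in ij.
move: pp lp up sp => /= /andP[giz pz] lp /andP[iNp up] sp.
exists z => //; have [->|zj] := eqVneq z j; [by left|right].
apply/le_anti/andP; split.
  apply: D_triangle; rewrite // 1?eq_sym //.
  by apply: contraNneq iNp => ->; rewrite mem_head.
rewrite -sp lerD ?edge_weight_ge//.
by have [_] := G_dist zj; apply.
Qed.

Lemma indecomposable_edge i j : indecomposable D i j -> G i j.
Proof.
case/indecomposableP=> ij dij; have [z giz [<-//|e]] := first_edge ij.
have [<-//|zj] := eqVneq z j.
have zi : z != i by apply/negP=> /eqP ez; move: giz; rewrite ez adj_irrefl.
by have := dij z zi zj; rewrite -e ltxx.
Qed.

End Realization.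

(** * The graph of indecomposable pairs realizes the family *)

Lemma indecomposable_irrefl : irreflexive (indecomposable D).
Proof. by move=> i; rewrite /indecomposable eqxx. Qed.

Lemma indecomposable_connected u v : connect (indecomposable D) u v.
Proof.
have [->|/indec_walk[p [pp <- _]]] := eqVneq u v; first exact: connect0.
by apply/connectP; exists p.
Qed.

Definition indec_graph : sgraph V :=
  SGraph (indecomposable_sym D) indecomposable_irrefl indecomposable_connected.

Lemma indec_graph_weight_gt0 u v : indec_graph u v -> 0 < D [set u; v].
Proof. by move/indecomposable_neq/D_gt0. Qed.

Definition indec_pwgraph : pwgraph R V := PWGraph indec_graph_weight_gt0.

Lemma indec_pwgraph_dist i j : i != j -> is_wdist indec_pwgraph i j (pair_val D i j).
Proof.
move=> ij.
have lb p : gpath indec_pwgraph i j p -> pair_val D i j <= chain_sum D i p.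
  by case=> pp lp _; rewrite -lp; apply: pair_val_le_chain_sum; rewrite ?lp.
split=> //; have [p [pp lp sp]] := indec_walk ij.
have [q [pq lq uq le_qp]] := chain_sum_shorten indecomposable_ge0 pp.
have gq : gpath indec_pwgraph i j q by split=> //; rewrite lq.
by exists q => //; apply/le_anti; rewrite lb// andbT -sp.
Qed.

End Metric.

Theorem theorem5p4 (R : realType) (n : nat) (D : {set 'I_n} -> R)
    (D_gt0 : forall I : {set 'I_n}, #|I| = 2%N -> 0 < D I)
    (D_triangle : triangle_inequalities D)
    (x y : 'I_n) (x_neq_y : x != y)
    (Dxy_min : forall i j : 'I_n, (i < j)%N ->
       pair_val D x y <= pair_val D i j) :
  (exists X' Y' : {set 'I_n}, bigraphlike_on D X' Y')
  <->
  Xset D x y :&: Yset D x = set0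
  /\ ((forall a b : 'I_n, a \in Xset D x y -> b \in Xset D x y -> a != b ->
         exists2 z : 'I_n, z \in Yset D x &
           pair_val D a b = pair_val D a z + pair_val D z b)
      /\
      (forall a b : 'I_n, a \in Yset D x -> b \in Yset D x -> a != b ->
         exists2 z : 'I_n, z \in Xset D x y &
           pair_val D a b = pair_val D a z + pair_val D z b)).
Proof.
have Dgt0 i j : i != j -> 0 < pair_val D i j by move=> ij; rewrite D_gt0// cards2 ij.
have Dmin i j : i != j -> pair_val D x y <= pair_val D i j.
  by rewrite -val_eqE neq_ltn => /orP[] /Dxy_min//; rewrite (pair_valC D j).
have dxy : indecomposable D x y.
  apply/indecomposableP; split=> // z zx zy.
  by rewrite (le_lt_trans (Dmin x z _)) ?ltrDl ?Dgt0// eq_sym.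
split=> [[X' [Y' [G [[XY0 XYT GXY] Gdist]]]]|[XY0 [HX HY]]].
  have Y'C : Y' = ~: X'.
    apply/setP=> i; move/setP/(_ i): XY0; move/setP/(_ i): XYT; rewrite !inE.
    by case: (i \in X'); case: (i \in Y').
  (* [S] is whichever of the two sides contains [x]. *)
  have [S xS Sflip] : exists2 S : {set 'I_n}, x \in S &
      forall u v, G u v -> (v \in S) = (u \notin S).
    have flip u v : G u v -> (v \in X') = (u \notin X').
      by move=> /GXY; rewrite Y'C !inE => -[[-> /negPf->]|[/negPf-> ->]].
    have [xX|xX] := boolP (x \in X'); first by exists X'.
    by exists (~: X') => [|u v /flip]; rewrite !inE // => ->.
  have [-> ->] := Xset_Yset_coloring Dgt0 D_triangle
    (fun u v d => Sflip u v (indecomposable_edge D_triangle Gdist d)) xS dxy.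
  (* Vertices on the same side are not adjacent, so the first edge of a shortest path from [a] to
     [b] ends at an intermediate vertex on the other side. *)
  have between a b : (a \in S) = (b \in S) -> a != b ->
      exists2 z, (z \in S) = (a \notin S) &
        pair_val D a b = pair_val D a z + pair_val D z b.
    move=> abS /(first_edge D_triangle Gdist)[z /Sflip zS [zb|e]]; last by exists z.
    by move: zS; rewrite zb abS; case: (b \in S).
  split; first by rewrite setICr.
  split=> a b; rewrite ?inE => aS bS /between[|z zS e].
  - by rewrite aS bS.
  - by exists z; rewrite // inE zS aS.
  - by rewrite (negPf aS) (negPf bS).
  - by exists z; rewrite // zS.
exists (Xset D x y), (Yset D x), (indec_pwgraph Dgt0 D_triangle).
split; last exact: indec_pwgraph_dist.
have XorY i := Xset_Yset_cover Dgt0 D_triangle i dxy.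
have XYN i : i \in Xset D x y -> i \in Yset D x -> False.
  by move=> iX iY; move/setP/(_ i): XY0; rewrite in_setI iX iY in_set0.
(* Since [u] and [v] lie outside [Z], the witness [z] differs from both, so the equality contradicts
   strictness. *)
have not_indec u v (Z : {set 'I_n}) : u \notin Z -> v \notin Z ->
    (exists2 z, z \in Z & pair_val D u v = pair_val D u z + pair_val D z v) ->
    ~ indecomposable D u v.
  move=> uZ vZ [z zZ e] /indecomposableP[_ /(_ z)]; rewrite -e ltxx => H.
  by have := H (memPn uZ z zZ) (memPn vZ z zZ).
split=> // [|u v duv].
  by apply/setP=> i; rewrite in_setU in_setT XorY.
have uv := indecomposable_neq duv.
(* An indecomposable pair inside one side is excluded by (2), its ends lying outside the other side
   by (1). *)
have [uX|uY] := orP (XorY u); have [vX|vY] := orP (XorY v); [|by left|by right|].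
- by case: (not_indec u v (Yset D x) _ _ (HX _ _ uX vX uv) duv); apply/negP/XYN.
- by case: (not_indec u v (Xset D x y) _ _ (HY _ _ uY vY uv) duv);
    apply/negP => /XYN; apply.
Qed.
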